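(* For all positive integers $r, n$, \[ U_{2r}(n) = 2^{n+1} \sum_{1 \le j \le k \le r} (-1)^j \frac{\left(-\frac{n}{2}\right)_k \left(\frac12\right)_k}{(k-j)!\,(k+j)!}\,j^{2r}, \] \[ U_{2r+1}(2n) = 2n\binom{2n}{n}\sum_{1 \le j \le k \le r} (-1)^{j}\frac{(-n)_{k}}{(k-j)!\,(k+1)_j}\,j^{2r}, \] \[ U_{2r-1}(2n-1) = \binom{2n}{n}\sum_{1 \le j \le k \le r} (-1)^{j}\frac{(-n)_{k}}{(k-j)!\,(k)_j}\,\left(j-\tfrac12\right)^{2r-1}. \]
   Context: For $r\in\mathbb{N}$ and $n\in\mathbb{Z}$ define \[ U_r(n) = \sum_{k\in\mathbb{Z}} \binom{n}{k}\left|\frac{n}{2}-k\right|^r, \] where $0^0=1$, and for $n\ge0$ the binomial coefficient $\binom{n}{k}$ is $0$ if $k<0$ or $k>n$ and $\frac{n!}{(n-k)!\,k!}$ otherwise; $U_r(n)=0$ for $n<0$. For $k\in\mathbb{N}$ and real $x$, $(x)_k = x(x+1)\cdots(x+k-1)$ is the rising factorial (Pochhammer symbol), with $(x)_0=1$. *)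

(* Defs.v *)
From mathcomp Require Import all_boot all_order all_algebra.
From mathcomp Require Import classical_sets fsbigop reals.

Set Implicit Arguments.
Unset Strict Implicit.
Unset Printing Implicit Defensive.

Import Order.TTheory GRing.Theory Num.Theory.
Local Open Scope ring_scope.

Definition binz (n : nat) (k : int) : nat :=
  match k with
  | Posz m => 'C(n, m)
  | Negz _ => 0%N
  end.

(* The sum over all integers is the finitely supported sum of fsbigop: its
   terms vanish outside 0 <= k <= n. The convention 0 ^ 0 = 1 is expr0. *)
Definition U (R : realType) (r : nat) (n : int) : R :=
  match n with
  | Posz m =>
      \sum_(k \in [set: int])
        (binz m k)%:R * `|m%:R / 2 - k%:~R : R| ^+ r
  | Negz _ => 0
  end.

Definition pochhammer (R : realType) (x : R) (k : nat) : R :=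
  \prod_(i < k) (x + i%:R).

(* Main.v *)
Require Import Defs.
From mathcomp Require Import all_boot all_order all_algebra.
From mathcomp Require Import classical_sets fsbigop reals.
From mathcomp Require Import ring lra zify.

(* Write S_n(g) for the sum over m of C(n, m) g(n/2 - m). Since
   m (n - m) C(n, m) = n (n - 1) C(n - 2, m - 1), one has
   S_n(x^2 g) = (n/2)^2 S_n(g) - n (n - 1) S_(n-2)(g). By induction on k this
   evaluates S_n(phi * prod_(i <= k) (x^2 - y_i^2)) as a product of rising
   factorials for phi = x^2, |x|^3 (nodes y_i = i) and phi = |x| (nodes
   y_i = i - 1/2). Newton interpolation of x^(2d) at the squares y_i^2 then
   gives U_r(n), the inner sums over j being the divided differences. *)

Set Implicit Arguments.
Unset Strict Implicit.

Import Order.TTheory GRing.Theory Num.Theory.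
Local Open Scope ring_scope.

Lemma natr_fact_neq0 (R : numDomainType) (n : nat) : n`!%:R != 0 :> R.
Proof. by rewrite pnatr_eq0 -lt0n fact_gt0. Qed.

Ltac neq0 :=
  repeat (apply/andP; split);
  by [exact: natr_fact_neq0 | apply: lt0r_neq0; lra].

(** * Rising factorials *)

Section Pochhammer.
Variable R : realType.
Implicit Types (x : R) (k : nat).

Lemma pochhammer0 x : pochhammer x 0 = 1.
Proof. by rewrite /pochhammer big_ord0. Qed.

Lemma pochhammerS x k : pochhammer x k.+1 = pochhammer x k * (x + k%:R).
Proof. by rewrite /pochhammer big_ord_recr. Qed.

Lemma pochhammerSl x k : pochhammer x k.+1 = x * pochhammer (x + 1) k.
Proof.
rewrite /pochhammer big_ord_recl addr0; congr (_ * _).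
by apply: eq_bigr => i _; rewrite lift0 mulrS addrA.
Qed.

(** Replacing n by n - 2 turns -n/2 into -n/2 + 1; the inductions on the number of nodes compare
    rising factorials at these two arguments. *)
Lemma pochhammer_shift x k :
  x * pochhammer (x + 1) k = pochhammer x k * (x + k%:R).
Proof. by rewrite -pochhammerSl pochhammerS. Qed.

(** Turns 1/(k+1)_j and 1/(k)_j in the odd formulas into k!/(k+j)! and (k-1)!/(k+j-1)!, which match
    the closed forms and the weights. *)
Lemma pochhammer_fact m k :
  pochhammer (m.+1%:R : R) k = (m + k)`!%:R / m`!%:R.
Proof.
elim: k => [|k IHk]; first by rewrite pochhammer0 addn0 divff ?natr_fact_neq0.
rewrite pochhammerS IHk addnS factS natrM -natrD addSn.
by rewrite mulrAC [_`!%:R * _]mulrC.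
Qed.

End Pochhammer.

(** * Binomial sums and their recurrence *)

Section BinomialSum.
Variable R : realType.
Implicit Types (n m s : nat) (g h : R -> R).

Definition binomial_sum n g : R :=
  \sum_(m < n.+1) 'C(n, m)%:R * g (n%:R / 2 - m%:R).

Lemma eq_binomial_sum n g h : g =1 h -> binomial_sum n g = binomial_sum n h.
Proof. by move=> gh; apply: eq_bigr => m _; rewrite gh. Qed.

Lemma binomial_sumZ n c g :
  binomial_sum n (fun x => c * g x) = c * binomial_sum n g.
Proof. by rewrite /binomial_sum mulr_sumr; apply: eq_bigr => m _; ring. Qed.

Lemma binomial_sumB n g h :
  binomial_sum n (fun x => g x - h x) = binomial_sum n g - binomial_sum n h.
Proof. by rewrite /binomial_sum -sumrB; apply: eq_bigr => m _; ring. Qed.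

Lemma binomial_sum_sum n d (G : nat -> R -> R) :
  binomial_sum n (fun x => \sum_(k < d) G k x) =
  \sum_(k < d) binomial_sum n (G k).
Proof.
rewrite /binomial_sum exchange_big /=.
by apply: eq_bigr => m _; rewrite mulr_sumr.
Qed.

(* With x = n/2 - m one has x^2 = (n/2)^2 - m (n - m), and
   m (n - m) C(n, m) = n (n - 1) C(n - 2, m - 1). *)
Lemma binomial_sum_sqr n g :
  binomial_sum n (fun x => x ^+ 2 * g x) =
  (n%:R / 2) ^+ 2 * binomial_sum n g - (n * n.-1)%:R * binomial_sum n.-2 g.
Proof.
case: n => [|[|n]].
- by rewrite /binomial_sum !big_ord_recr !big_ord0 /= bin0; ring.
- by rewrite /binomial_sum !big_ord_recr !big_ord0 /= bin0 bin1; field.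
pose q m : R := m%:R * (n.+2%:R - m%:R).
have -> : binomial_sum n.+2 (fun x => x ^+ 2 * g x) =
    (n.+2%:R / 2) ^+ 2 * binomial_sum n.+2 g -
    \sum_(m < n.+3) 'C(n.+2, m)%:R * q m * g (n.+2%:R / 2 - m%:R).
  rewrite /binomial_sum mulr_sumr -sumrB; apply: eq_bigr => m _.
  by rewrite /q; field.
(* The two extreme terms vanish with [q]; the others, shifted by one, are those of the sum for
   [n]. *)
congr (_ - _); rewrite big_ord_recl big_ord_recr /= /q.
rewrite mul0r mulr0 mul0r add0r subrr !mulr0 mul0r addr0.
rewrite /binomial_sum mulr_sumr; apply: eq_bigr => m _.
rewrite /bump /= add1n.
have -> : n.+2%:R / 2 - m.+1%:R = n%:R / 2 - m%:R :> R.
  by rewrite !mulrS; field.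
rewrite !mulrA; congr (_ * _).
have hm : (m <= n)%N by rewrite -ltnS.
rewrite -natrB ?ltnS 1?leqW // -!natrM; congr (_%:R).
have h1 := mul_bin_diag n.+2 m; have h2 := mul_bin_down n.+1 m.
rewrite /= in h1 h2 *.
by rewrite subSS [('C(_, _) * _)%N]mulnC -h1 -mulnA
  [('C(_, _) * _)%N]mulnC -h2 mulnA.
Qed.

Lemma binomial_sum1 n : binomial_sum n (fun=> 1) = 2 ^+ n.
Proof.
rewrite -[2]/(1 + 1) exprDn; apply: eq_bigr => m _.
by rewrite !expr1n !mulr1.
Qed.

(* 2 C(n, m) (n/2 - m) = (m + 1) C(n, m + 1) - m C(n, m) telescopes, and
   n/2 - m changes sign at m = s. *)
Lemma binomial_sum_norm n s : (n <= s.*2 <= n.+1)%N ->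
  binomial_sum n (fun x => `|x|) = (s * 'C(n, s))%:R.
Proof.
move=> /andP[ns sn].
pose h m : R := (m * 'C(n, m))%:R.
have step m : (m <= n)%N ->
    'C(n, m)%:R * (n%:R / 2 - m%:R) = (h m.+1 - h m) / 2.
  by move=> mn; rewrite /h mul_bin_left !natrM natrB //; field.
have sn1 : (s <= n.+1)%N by lia.
have -> : binomial_sum n (fun x => `|x|) =
    \sum_(0 <= m < n.+1) 'C(n, m)%:R * `|n%:R / 2 - m%:R| by rewrite big_mkord.
rewrite (big_cat_nat (n := s)) //=.
have -> : \sum_(0 <= m < s) 'C(n, m)%:R * `|n%:R / 2 - m%:R| =
    \sum_(0 <= m < s) (h m.+1 - h m) / 2.
  rewrite !big_nat; apply: eq_bigr => m /andP[_ ms]; rewrite -step; last by lia.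
  rewrite ger0_norm // subr_ge0 ler_pdivlMr // -natrM ler_nat; lia.
have -> : \sum_(s <= m < n.+1) 'C(n, m)%:R * `|n%:R / 2 - m%:R| =
    - \sum_(s <= m < n.+1) (h m.+1 - h m) / 2.
  rewrite !big_nat -sumrN; apply: eq_bigr => m /andP[sm mn].
  rewrite -step -?mulrN; last by lia.
  rewrite ler0_norm // subr_le0 ler_pdivrMr // -natrM ler_nat; lia.
(* Since [h 0] and [h n.+1] vanish, each half contributes [h s / 2]. *)
rewrite -!mulr_suml !telescope_sumr // /h (bin_small (ltnSn n)) muln0 mul0n.
by field.
Qed.

Lemma U_binomial_sum r n : U R r n%:Z = binomial_sum n (fun x => `|x| ^+ r).
Proof.
rewrite /U (@fsbigE _ _ _ _ _ [seq Posz m | m <- index_iota 0 n.+1]).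
- rewrite big_map big_mkord; apply: eq_bigl => m.
  by rewrite mem_set.
- by rewrite map_inj_uniq ?iota_uniq // => ? ? [].
- by [].
- move=> [m|m] _ hm; last by rewrite mul0r.
  rewrite /= bin_small ?mul0r // ltnNge; apply: contra hm => hm.
  by rewrite (map_f Posz) // mem_index_iota.
Qed.

End BinomialSum.

(** * Newton interpolation at the squared nodes *)

Section Newton.
Context {R : realType} (b : bool).
Implicit Types (d K J : nat).

(* The nodes are 1, 2, 3, ... if b is true and 1/2, 3/2, 5/2, ... otherwise. *)
Definition node J : R := J%:R + (1 + b%:R) / 2.

Definition node_prod K (x : R) : R := \prod_(i < K) (x ^+ 2 - node i ^+ 2).

(* [node J ^+ (2 * d) * weight K J] sums over J to the divided difference of
   t ^+ d at the squares of the first K.+1 nodes. *)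
Definition weight K J : R :=
  2 * (-1) ^+ (K + J) * node J ^+ b.+1 / ((K - J)`! * (K + J + b).+1`!)%:R.

Definition newton_coef d K : R :=
  \sum_(J < K.+1) weight K J * node J ^+ (2 * d).

(** For J <= K, [weight K J] is the inverse of the product of [node J ^+ 2 - node i ^+ 2] over i <=
    K, i != J; a new node adds one factor. *)
Lemma weightS K J : (J <= K)%N ->
  weight K.+1 J * (node J ^+ 2 - node K.+1 ^+ 2) = weight K J.
Proof.
move=> JK; rewrite /weight /node -(subnK JK); set m := (K - J)%N.
rewrite -addSn !addnK !addSn !factS !natrM exprS.
have := ler0n R J; have := ler0n R m.
by case: b => /= m0 J0; field; neq0.
Qed.

(** This is the divided difference of the constant 1 at two or more nodes. *)
Lemma sum_weight K : \sum_(J < K.+2) weight K.+1 J = 0.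
Proof.
(* A telescoping certificate with [t 0 = 0]. It stops before J = K + 1, as truncated subtraction
   makes [t K.+2] nonzero; that last term is split off and cancels what [t K.+1] leaves. *)
pose t J : R := (-1) ^+ (K.+1 + J) * J%:R * J.+1%:R ^+ b /
  ((K.+1 - J)`! * (K.+1 + J + b)`!)%:R.
have step J : (J < K.+1)%N -> weight K.+1 J = (t J - t J.+1) / K.+1%:R.
  rewrite ltnS => JK; rewrite /weight /t /node -(subnK JK).
  set m := (K - J)%N; rewrite -addSn addnK addSn subSS addnK.
  rewrite addnS !addSn !factS !natrM !exprS.
  have := ler0n R J; have := ler0n R m; set e := (-1) ^+ _.
  by case: b => /= m0 J0; field; neq0.
rewrite big_ord_recr /= (eq_bigr (fun J : 'I_K.+1 => (t J - t J.+1) / K.+1%:R)).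
  rewrite -mulr_suml -(big_mkord xpredT (fun J => t J - t J.+1)).
  have -> : \sum_(0 <= J < K.+1) (t J - t J.+1) = - t K.+1.
    rewrite -[LHS]opprK -sumrN (eq_bigr (fun J => t J.+1 - t J)) => [|J _].
      by rewrite telescope_sumr // /t mulr0 !mul0r subr0.
    by rewrite opprB.
  rewrite /t /weight /node subnn !addSn !factS !natrM.
  have := ler0n R K; set e := (-1) ^+ _.
  by case: b => /= K0; field; neq0.
by move=> J _; apply: step.
Qed.

Lemma newton_coef0 d : newton_coef d 0 = node 0 ^+ (2 * d).
Proof.
rewrite /newton_coef big_ord_recr big_ord0 /= add0r /weight /node.
have -> : ((0 - 0)`! * (0 + 0 + b).+1`!)%N = b.+1 by case: b.
by set e := _ ^+ (2 * d); case: b @e => e /=; field.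
Qed.

Lemma newton_coef0S K : newton_coef 0 K.+1 = 0.
Proof.
rewrite -[RHS](sum_weight K); apply: eq_bigr => J _.
by rewrite mulr1.
Qed.

(** Split [node J ^+ 2] as [(node J ^+ 2 - node K.+1 ^+ 2) + node K.+1 ^+ 2]: the difference kills
    the term J = K + 1 and lowers the other weights by [weightS]. *)
Lemma newton_coefS d K : newton_coef d.+1 K.+1 =
  newton_coef d K + node K.+1 ^+ 2 * newton_coef d K.+1.
Proof.
apply/eqP; rewrite -subr_eq; apply/eqP.
rewrite /newton_coef mulr_sumr -sumrB big_ord_recr /= mulnS exprD.
rewrite mulrCA subrr addr0; apply: eq_bigr => J _.
by rewrite exprD -(@weightS K) -1?ltnS //; ring.
Qed.

Lemma newton_coef_small d K : (d < K)%N -> newton_coef d K = 0.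
Proof.
elim: d K => [|d IHd] [|K] // dK; first exact: newton_coef0S.
by rewrite newton_coefS !IHd ?mulr0 ?addr0 //; lia.
Qed.

Lemma newton_expansion d x :
  x ^+ (2 * d) = \sum_(K < d.+1) newton_coef d K * node_prod K x.
Proof.
elim: d => [|d IHd].
  by rewrite big_ord1 newton_coef0 /node_prod big_ord0 mul1r.
rewrite big_ord_recl newton_coef0 /node_prod big_ord0 mulr1.
rewrite mulnS exprD IHd mulr_sumr.
pose c K := newton_coef d K; pose p K := node_prod K x.
(* Uses [x ^+ 2 * p K = p K.+1 + node K ^+ 2 * p K]. *)
transitivity (\sum_(K < d.+1) c K * p K.+1 +
              \sum_(K < d.+1) node K ^+ 2 * (c K * p K)).
  rewrite -big_split; apply: eq_bigr => K _.
  by rewrite /p /node_prod big_ord_recr /= /c; ring.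
have -> : \sum_(K < d.+1) node K ^+ 2 * (c K * p K) =
    \sum_(K < d.+2) node K ^+ 2 * (c K * p K).
  by rewrite [RHS]big_ord_recr /= /c newton_coef_small // mul0r mulr0 addr0.
rewrite [X in _ + X]big_ord_recl /= addrCA; congr (_ + _).
  by rewrite /p /node_prod big_ord0 mulr1 /c newton_coef0 exprD.
rewrite -big_split; apply: eq_bigr => K _ /=.
by rewrite newton_coefS /c /p /node_prod; ring.
Qed.

(** Only the even power is interpolated; [phi] carries the remaining factor, which need not be a
    polynomial. *)
Lemma binomial_sum_newton n d (phi : R -> R) :
  binomial_sum n (fun x => phi x * x ^+ (2 * d)) =
  \sum_(K < d.+1) newton_coef d K *
    binomial_sum n (fun x => phi x * node_prod K x).
Proof.
under [RHS]eq_bigr do rewrite -binomial_sumZ.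
rewrite -(binomial_sum_sum n d.+1
  (fun K x => newton_coef d K * (phi x * node_prod K x))).
apply: eq_binomial_sum => x.
rewrite newton_expansion mulr_sumr.
by apply: eq_bigr => K _; rewrite mulrCA.
Qed.

Lemma binomial_sum_node_prodS n K (phi : R -> R) :
  binomial_sum n (fun x => phi x * node_prod K.+1 x) =
  ((n%:R / 2) ^+ 2 - node K ^+ 2) *
    binomial_sum n (fun x => phi x * node_prod K x) -
  (n * n.-1)%:R * binomial_sum n.-2 (fun x => phi x * node_prod K x).
Proof.
set g := fun x => phi x * node_prod K x.
rewrite (@eq_binomial_sum _ _ _ (fun x => x ^+ 2 * g x - node K ^+ 2 * g x)).
  by rewrite binomial_sumB binomial_sumZ binomial_sum_sqr; ring.
by move=> x; rewrite /g /node_prod big_ord_recr /=; ring.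
Qed.

End Newton.

(** * Closed forms for sums of node products *)

Section NodeProd.
Variable R : realType.

(** The ratio of consecutive central binomials, multiplied by n + 1 so that the coefficient (2n +
    2)(2n + 1) of the recurrence from 2n + 2 to 2n appears. *)
Lemma mul_central_binS n :
  n.+1%:R ^+ 2 * 'C(2 * n.+1, n.+1)%:R =
  2 * n.+1%:R * (2 * n%:R + 1) * 'C(2 * n, n)%:R :> R.
Proof.
have h1 := mul_bin_diag (2 * n.+1) n; have h2 := mul_bin_down (2 * n).+1 n.
rewrite mulnS /= in h1 h2 *.
have e : ((2 * n).+1 - n = n.+1)%N by lia.
rewrite e in h2.
have {}h1 : n.+1%:R * 'C((2 * n).+2, n.+1)%:R =
    (2 * n).+2%:R * 'C((2 * n).+1, n)%:R :> R by rewrite -!natrM h1.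
have {}h2 : n.+1%:R * 'C((2 * n).+1, n)%:R =
    (2 * n).+1%:R * 'C(2 * n, n)%:R :> R by rewrite -!natrM h2.
by rewrite expr2 -mulrA h1 mulrCA h2; ring.
Qed.

Lemma binomial_sum_sqr_node_prod n K :
  binomial_sum n (fun x : R => x ^+ 2 * node_prod true K x) =
  2 ^+ n * (-1) ^+ K.+1 *
    (pochhammer (- (n%:R / 2)) K.+1 * pochhammer (1 / 2) K.+1).
Proof.
elim: K n => [|K IHK] n.
  rewrite (@eq_binomial_sum _ _ _ (fun x => x ^+ 2 * 1)); last first.
    by move=> x; rewrite /node_prod big_ord0.
  rewrite binomial_sum_sqr !binomial_sum1 !pochhammerS !pochhammer0.
  by case: n => [|[|n]] /=; rewrite ?exprS; field.
rewrite (binomial_sum_node_prodS _ _ _ (fun x : R => x ^+ 2)) !IHK.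
rewrite [pochhammer (1 / 2) K.+2]pochhammerS.
set c := pochhammer (1 / 2) K.+1.
rewrite [(-1) ^+ K.+2]exprS; set e := (-1) ^+ K.+1.
(* For n = 0 and n = 1 the truncated [n.-2] is harmless, its coefficient n (n - 1) being 0. *)
rewrite /node; case: n => [|[|n]].
- by rewrite !pochhammerSl !mul0r oppr0 !mul0r; ring.
- by rewrite [pochhammer _ K.+2]pochhammerS /= muln0 mul0r subr0; field.
have -> : - (n.+2.-2%:R / 2) = - (n.+2%:R / 2) + 1 :> R by rewrite /=; field.
set a := - (n.+2%:R / 2) : R.
have rel := pochhammer_shift a K.+1.
rewrite [pochhammer a K.+2]pochhammerSl.
set p := pochhammer a _ in rel *; set p' := pochhammer (a + 1) _ in rel *.
(* The difference of squares factors as (a - (K + 1)) (a + (K + 1)); the second factor is grouped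
   with [p] so that [rel] applies. *)
transitivity (2 ^+ n.+2 * e * c * (a - K.+1%:R) * (p * (a + K.+1%:R))
  - (n.+2 * n.+1)%:R * (2 ^+ n * e * (p' * c))).
  by rewrite /a /node /=; field.
by rewrite -rel /a !exprS; field.
Qed.

(* As [|x|] is not a polynomial, the closed forms for odd powers rest on
   [binomial_sum_norm]; the recurrence [binomial_sum_node_prodS] holds for any
   factor [phi], so the induction is the same as in the even case. *)
Lemma binomial_sum_cube_node_prod n K :
  binomial_sum (2 * n) (fun x : R => `|x| * x ^+ 2 * node_prod true K x) =
  n%:R * 'C(2 * n, n)%:R * (-1) ^+ K.+1 *
    (pochhammer (- n%:R) K.+1 * K.+1`!%:R).
Proof.
have predE m : ((2 * m.+1).-2 = 2 * m)%N by rewrite mulnS.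
have prodE m : (2 * m.+1 * (2 * m.+1).-1)%:R =
    2 * m.+1%:R * (2 * m%:R + 1) :> R.
  by rewrite mulnS /=; ring.
elim: K n => [|K IHK] n.
  rewrite (@eq_binomial_sum _ _ _ (fun x => x ^+ 2 * `|x|)); last first.
    by move=> x; rewrite /node_prod big_ord0 mulr1 mulrC.
  rewrite binomial_sum_sqr (@binomial_sum_norm _ _ n) -?mul2n ?leqnn ?leqnSn //.
  rewrite pochhammerS pochhammer0; case: n => [|n].
    by rewrite !mul0n; ring.
  rewrite predE prodE (@binomial_sum_norm _ _ n) -?mul2n ?leqnn ?leqnSn //.
  have rel := mul_central_binS n.
  set C := 'C(2 * n.+1, n.+1) in rel *; set D := 'C(2 * n, n) in rel *.
  transitivity (n.+1%:R ^+ 2 * n.+1%:R * C%:R -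
    n%:R * (2 * n.+1%:R * (2 * n%:R + 1) * D%:R) : R); first by field.
  by rewrite -rel factS fact0 muln1; ring.
rewrite (binomial_sum_node_prodS _ _ _ (fun x : R => `|x| * x ^+ 2)) !IHK.
case: n => [|n]; first by rewrite muln0 !mul0r; ring.
rewrite predE prodE IHK [K.+2`!]factS natrM.
rewrite [(-1) ^+ K.+2]exprS; set e := (-1) ^+ K.+1.
have -> : - n%:R = - n.+1%:R + 1 :> R by ring.
set a := - n.+1%:R : R.
have rel := pochhammer_shift a K.+1; have crel := mul_central_binS n.
rewrite [pochhammer a K.+2]pochhammerSl.
set p := pochhammer a _ in rel *; set p' := pochhammer (a + 1) _ in rel *.
set C := 'C(2 * n.+1, n.+1) in crel *; set D := 'C(2 * n, n) in crel *.
set f := K.+1`!; rewrite /node.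
transitivity
  (n.+1%:R * C%:R * e * f%:R * (a - K.+1%:R) * (p * (a + K.+1%:R))
  - 2 * n.+1%:R * (2 * n%:R + 1) * D%:R * (n%:R * e * (p' * f%:R))).
  by rewrite /a /=; field.
by rewrite -rel -crel /a; ring.
Qed.

(** With half-integer nodes, ((2n + 1)/2)^2 - (K + 1/2)^2 = (n - K) (n + K + 1), whose first factor
    extends the rising factorial of -(n + 1). *)
Lemma binomial_sum_norm_node_prod n K :
  binomial_sum (2 * n).+1 (fun x : R => `|x| * node_prod false K x) =
  'C(2 * n.+1, n.+1)%:R * (-1) ^+ K.+1 *
    (pochhammer (- n.+1%:R) K.+1 * K`!%:R) / 2.
Proof.
elim: K n => [|K IHK] n.
  rewrite (@eq_binomial_sum _ _ _ (fun x => `|x|)); last first.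
    by move=> x; rewrite /node_prod big_ord0 mulr1.
  rewrite (@binomial_sum_norm _ _ n.+1); last by lia.
  (* Pascal's rule and symmetry give C(2n + 2, n + 1) = 2 C(2n + 1, n + 1), whence the division by
     2. *)
  rewrite pochhammerS pochhammer0 mulnS add2n (binS (2 * n).+1).
  rewrite -(@bin_sub (2 * n).+1 n); last by lia.
  have -> : ((2 * n).+1 - n = n.+1)%N by lia.
  by rewrite fact0; field.
rewrite (binomial_sum_node_prodS _ _ _ (fun x : R => `|x|)) !IHK.
rewrite factS [(-1) ^+ K.+2]exprS; set e := (-1) ^+ K.+1.
case: n => [|n].
  have -> : ((2 * 0).+1 * (2 * 0).+1.-1 = 0)%N by [].
  rewrite mul0r subr0 [pochhammer _ K.+2]pochhammerS /node.
  set p := pochhammer _ _; set C := 'C(_, _); set f := K`!.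
  by rewrite /=; field.
have -> : ((2 * n.+1).+1.-2 = (2 * n).+1)%N by rewrite mulnS.
rewrite IHK -/e.
have -> : - n.+1%:R = - n.+2%:R + 1 :> R by ring.
set a := - n.+2%:R : R.
have rel := pochhammer_shift a K.+1.
have crel : n.+2%:R * 'C(2 * n.+2, n.+2)%:R =
    2 * (2 * n.+1%:R + 1) * 'C(2 * n.+1, n.+1)%:R :> R.
  apply: (@mulfI _ n.+2%:R); first by rewrite pnatr_eq0.
  by rewrite mulrA -expr2 mul_central_binS; ring.
rewrite [pochhammer a K.+2]pochhammerSl.
set p := pochhammer a _ in rel *; set p' := pochhammer (a + 1) _ in rel *.
set C := 'C(2 * n.+2, n.+2) in crel *; set D := 'C(2 * n.+1, n.+1) in crel *.
set f := K`!; rewrite /node.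
transitivity
  (C%:R * e * f%:R / 2 * (a - K%:R) * (p * (a + K.+1%:R))
  - 2 * (2 * n.+1%:R + 1) * D%:R * (n.+1%:R * e * (p' * f%:R) / 2)).
  by rewrite /a /=; field.
by rewrite -rel -crel /a; field.
Qed.

End NodeProd.

(** * Assembling the three formulas *)

(** The signs of the weight and of the closed form combine to (-1)^j with j = J + 1. *)
Lemma signr_addSS (R : pzRingType) K J :
  (-1) ^+ J.+1 = (-1) ^+ (K + J) * (-1) ^+ K.+1 :> R.
Proof.
rewrite -exprD -signr_odd -[RHS]signr_odd !oddD /=.
by case: (odd K); case: (odd J).
Qed.

Unset Implicit Arguments.

Theorem theorem3 (R : realType) (r n : nat) (r_gt0 : (0 < r)%N)
    (n_gt0 : (0 < n)%N) :
  [/\ U R (2 * r)%N n%:Z =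
        2 ^+ n.+1 *
        \sum_(1 <= k < r.+1) \sum_(1 <= j < k.+1)
          (-1) ^+ j *
          (pochhammer (- (n%:R / 2)) k * pochhammer (1 / 2) k /
           ((k - j)`! * (k + j)`!)%:R) *
          j%:R ^+ (2 * r)%N,
      U R (2 * r + 1)%N (2 * n%:Z) =
        2 * n%:R * ('C(2 * n, n))%:R *
        \sum_(1 <= k < r.+1) \sum_(1 <= j < k.+1)
          (-1) ^+ j *
          (pochhammer (- n%:R) k /
           ((k - j)`!%:R * pochhammer (k%:R + 1) j)) *
          j%:R ^+ (2 * r)%N
    & U R (2 * r - 1)%N (2 * n%:Z - 1) =
        ('C(2 * n, n))%:R *
        \sum_(1 <= k < r.+1) \sum_(1 <= j < k.+1)
          (-1) ^+ j *
          (pochhammer (- n%:R) k /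
           ((k - j)`!%:R * pochhammer k%:R j)) *
          (j%:R - 1 / 2) ^+ (2 * r - 1)%N].
Proof.
(* With r = d + 1, k = K + 1 and j = J + 1, the power of [node J] in the weight restores the
   exponent that [phi] took from the interpolated power. *)
case: r r_gt0 => // d _; case: n n_gt0 => // n0 _; set n := n0.+1.
split.
- rewrite U_binomial_sum.
  rewrite (@eq_binomial_sum _ _ _ (fun x => x ^+ 2 * x ^+ (2 * d))); last first.
    by move=> x; rewrite exprM (real_normK (num_real x)) exprS exprM.
  rewrite (binomial_sum_newton true) big_add1 big_mkord mulr_sumr.
  apply: eq_bigr => K _; rewrite binomial_sum_sqr_node_prod.
  rewrite /newton_coef mulr_suml big_add1 big_mkord mulr_sumr.
  apply: eq_bigr => J _; rewrite (signr_addSS R K J) /weight.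
  set e1 := (-1) ^+ (K + J); set e2 := (-1) ^+ K.+1.
  have nJ : node true J = J.+1%:R :> R by rewrite /node /=; field.
  rewrite nJ mulnS exprD exprS subSS addSn addnS addn1.
  set p := pochhammer _ _ * _; set f := (_ * _)%N%:R^-1.
  by rewrite /= expr1 [2 ^+ n.+1]exprS; ring.
- have -> : 2 * n%:Z = (2 * n)%N by lia.
  rewrite U_binomial_sum.
  rewrite (@eq_binomial_sum _ _ _
    (fun x => `|x| * x ^+ 2 * x ^+ (2 * d))); last first.
    move=> x; rewrite addn1 exprS exprM (real_normK (num_real x)).
    by rewrite exprS -mulrA exprM.
  rewrite (binomial_sum_newton true) big_add1 big_mkord mulr_sumr.
  apply: eq_bigr => K _; rewrite binomial_sum_cube_node_prod.
  rewrite /newton_coef mulr_suml big_add1 big_mkord mulr_sumr.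
  apply: eq_bigr => J _; rewrite (signr_addSS R K J) /weight.
  set e1 := (-1) ^+ (K + J); set e2 := (-1) ^+ K.+1.
  have nJ : node true J = J.+1%:R :> R by rewrite /node /=; field.
  rewrite nJ mulnS exprD subSS natr1 pochhammer_fact addn1 addSn addnS.
  by rewrite natrM !invfM invrK /= ?expr1; ring.
- have -> : 2 * n%:Z - 1 = (2 * n0).+1 by rewrite /n; lia.
  rewrite U_binomial_sum (_ : 2 * d.+1 - 1 = (2 * d).+1)%N; last by lia.
  rewrite (@eq_binomial_sum _ _ _ (fun x => `|x| * x ^+ (2 * d))); last first.
    by move=> x; rewrite exprS !exprM (real_normK (num_real x)).
  rewrite (binomial_sum_newton false) big_add1 big_mkord mulr_sumr.
  apply: eq_bigr => K _; rewrite binomial_sum_norm_node_prod.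
  rewrite /newton_coef mulr_suml big_add1 big_mkord mulr_sumr.
  apply: eq_bigr => J _; rewrite (signr_addSS R K J) /weight.
  set e1 := (-1) ^+ (K + J); set e2 := (-1) ^+ K.+1.
  have nJ : node false J = J.+1%:R - 1 / 2 :> R by rewrite /node /=; field.
  rewrite nJ; set y := J.+1%:R - 1 / 2.
  rewrite [y ^+ (2 * d).+1]exprS subSS pochhammer_fact addn0 addnS.
  rewrite natrM /= expr1; set q := y ^+ (2 * d).
  by field; neq0.
Qed.
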